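(* Let $f:(0,\infty)\to\mathbb{R}$ be smooth and let $g=e^{2f(r)}(-dt^2+dr^2+dz^2)+r^2e^{-2f(r)}d\phi^2$ on $M=\{(t,r,z)\in\mathbb{R}^3:r>0\}\times S^1$, with $\phi$ the angular coordinate on $S^1$. The Weyl conformal curvature tensor of $(M,g)$ vanishes if and only if $$rf''-2rf'^2+2f'=0 .$$
   Context: Primes denote derivatives with respect to $r$. *)

(* Defs.v *)
From HB Require Import structures.
From mathcomp Require Import all_boot all_order all_algebra.
From mathcomp Require Import all_classical all_reals all_analysis.
Set Implicit Arguments.
Unset Strict Implicit.
Unset Printing Implicit Defensive.
Import Order.TTheory GRing.Theory Num.Theory.
Import numFieldNormedType.Exports.
Local Open Scope ring_scope.
Local Open Scope classical_set_scope.

Definition smooth_on (R : realType) (A : set R) (f : R -> R) : Prop :=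
  forall (n : nat) (x : R), A x -> derivable (f^`(n)) x 1.

(* Curvature of a pseudo-Riemannian metric given by its matrix [g x] of
   components in a local coordinate system [x] of an [m.+1]-manifold. *)
Section Curvature.
Variables (R : realType) (m : nat).
Local Notation pt := 'rV[R]_m.+1.
Local Notation idx := 'I_m.+1.

Definition partial (i : idx) (F : pt -> R) (x : pt) : R :=
  'D_(delta_mx 0 i) F x.

Variable g : pt -> 'M[R]_m.+1.

(* Gamma^k_{ij} of the Levi-Civita connection *)
Definition christoffel (k i j : idx) (x : pt) : R :=
  2^-1 * \sum_(l < m.+1) invmx (g x) k l *
    (partial i (fun y => g y j l) x + partial j (fun y => g y i l) x
     - partial l (fun y => g y i j) x).

(* R^l_{kij}, with R(d_i, d_j) d_k = R^l_{kij} d_l *)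
Definition riemann (l k i j : idx) (x : pt) : R :=
  partial i (christoffel l j k) x - partial j (christoffel l i k) x
  + \sum_(p < m.+1) (christoffel l i p x * christoffel p j k x
                     - christoffel l j p x * christoffel p i k x).

(* R_{lkij} *)
Definition riemann_low (l k i j : idx) (x : pt) : R :=
  \sum_(p < m.+1) g x l p * riemann p k i j x.

(* Ric_{kj} = R^i_{kij}, positive on round spheres *)
Definition ricci (k j : idx) (x : pt) : R :=
  \sum_(i < m.+1) riemann i k i j x.

Definition scalar_curv (x : pt) : R :=
  \sum_(k < m.+1) \sum_(j < m.+1) invmx (g x) k j * ricci k j x.

(* W_{lkij} in dimension m.+1; meaningful for dimension at least 3 *)
Definition weyl (l k i j : idx) (x : pt) : R :=
  let n : R := m.+1%:R in
  riemann_low l k i j x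
  - (n - 2)^-1 * (g x l i * ricci k j x - g x l j * ricci k i x
                  + g x k j * ricci l i x - g x k i * ricci l j x)
  + scalar_curv x / ((n - 1) * (n - 2))
    * (g x l i * g x k j - g x l j * g x k i).

End Curvature.

(* The manifold {(t,r,z) : r > 0} x S^1, as the submanifold of R^5 with
   coordinates (t, r, z, u, v), where S^1 is the circle u^2 + v^2 = 1. *)
Section Spacetime.
Variable R : realType.

Definition spacetime : set 'rV[R]_5 :=
  [set p | 0 < p 0 1 /\ p 0 3 ^+ 2 + p 0 4 ^+ 2 = 1].

(* On the unit circle, dphi is the restriction of u dv - v du. *)
Definition dphi (p : 'rV[R]_5) : 'rV[R]_5 :=
  \row_k [:: 0; 0; 0; - p 0 4; p 0 3]`_k.

(* The matrix of a symmetric bilinear form on R^5, whose restriction to the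
   tangent space of [spacetime] at [p] is the metric
   e^{2f}(-dt^2 + dr^2 + dz^2) + r^2 e^{-2f} dphi^2. *)
Definition metric (f : R -> R) (p : 'rV[R]_5) : 'M[R]_5 :=
  let r := p 0 1 in
  expR (2 * f r) *: diag_mx (\row_k [:: -1; 1; 1; 0; 0]`_k)
  + (r ^+ 2 * expR (- (2 * f r))) *: ((dphi p)^T *m dphi p).

(* (t, r, z, phi) |-> (t, r, z, cos phi, sin phi); the local inverses of its
   restriction to {r > 0} form an atlas of [spacetime]. *)
Definition param (x : 'rV[R]_4) : 'rV[R]_5 :=
  \row_k [:: x 0 0; x 0 1; x 0 2; cos (x 0 3); sin (x 0 3)]`_k.

(* Components of the metric in the coordinates (t, r, z, phi). The library's
   Jacobian acts on row vectors, i.e. its (i, k) entry is d_i param^k. *)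
Definition metric_coord (f : R -> R) (x : 'rV[R]_4) : 'M[R]_4 :=
  'J param x *m metric f (param x) *m ('J param x)^T.

Definition weyl_vanishes (f : R -> R) : Prop :=
  forall p, spacetime p -> forall x, param x = p ->
  forall l k i j : 'I_4, weyl (metric_coord f) l k i j x = 0.

End Spacetime.

(* Main.v *)
(* In the coordinates (t, r, z, phi) the metric is diagonal with entries G_i
   depending on r only. For such a metric, with H_i = G_i' / (2 G_i), the only
   curvature components are sectional curvatures K_lk of coordinate planes, so
   W_lkij = C_lk G_l G_k (delta_li delta_kj - delta_lj delta_ki) with C_lk a
   linear combination of the K's. Here H = (f', f', f', 1/r - f'), and all C_lk
   with l != k are nonzero constant multiples of
   e^{-2f} (f'' - 2 f'^2 + 2 f'/r). *)

Require Import Defs.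
From HB Require Import structures.
From mathcomp Require Import all_boot all_order all_algebra.
From mathcomp Require Import all_classical all_reals all_analysis.
From mathcomp Require Import ring.

Set Implicit Arguments.
Unset Strict Implicit.
Unset Printing Implicit Defensive.
Import Order.TTheory GRing.Theory Num.Theory.
Import numFieldNormedType.Exports.
Local Open Scope ring_scope.
Local Open Scope classical_set_scope.

(** * Partial derivatives of functions of a single coordinate, and inverses of diagonal matrices *)

Lemma partial_coord (R : realType) n (h : R -> R) (i e : 'I_n.+1) (x : 'rV[R]_n.+1) :
  partial i (fun y => h (y 0 e)) x = (i == e)%:R * h^`()%classic (x 0 e).
Proof.
rewrite /partial /derive /derive1.
have E t : (t *: delta_mx 0 i + x) 0 e = t * (i == e)%:R + x 0 e.
  by rewrite !mxE eqxx /= eq_sym.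
under [X in lim (X @ _)]funext => t do rewrite /= /shift /= E.
case: (i == e); rewrite ?mul1r ?mul0r.
  by under [X in lim (X @ _)]funext => t do rewrite mulr1.
under [X in lim (X @ _)]funext => t do rewrite mulr0 add0r subrr scaler0.
exact: lim_cst.
Qed.

(** Positivity of a coordinate is an open condition, and a derivative depends only on nearby values.
    This serves to differentiate the Christoffel symbols, whose closed form is established only for
    [0 < x 0 e]. *)
Lemma partial_near_coord (R : realType) n (i e : 'I_n.+1) (x : 'rV[R]_n.+1)
    (F : 'rV[R]_n.+1 -> R) (h : R -> R) dh :
  (forall y : 'rV[R]_n.+1, 0 < y 0 e -> F y = h (y 0 e)) -> 0 < x 0 e ->
  is_derive (x 0 e) 1 h dh ->
  partial i F x = (i == e)%:R * dh.
Proof.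
move=> Fh x0 hd.
rewrite -[dh](@derive_val _ _ _ (x 0 e) 1 h) -derive1E -partial_coord.
apply: near_eq_derive.
have : nbhs x [set y : 'rV[R]_n.+1 | 0 < y 0 e].
  have c : {for x, continuous (fun y : 'rV[R]_n.+1 => y 0 e)} by exact: coord_continuous.
  exact: (cvgr_gt _ c).
by apply: filterS => y /Fh ->.
Qed.

Lemma differentiable_fun_coord (R : realType) n (h : R -> R) (e : 'I_n.+1)
    (x : 'rV[R]_n.+1) :
  derivable h (x 0 e) 1 -> differentiable (fun y : 'rV[R]_n.+1 => h (y 0 e)) x.
Proof.
move=> /derivable1_diffP dh.
apply: (@differentiable_comp _ _ _ _ (fun y : 'rV[R]_n.+1 => y 0 e) h) => //.
exact: differentiable_coord.
Qed.

Lemma invmx_diag (F : fieldType) n (d : 'rV[F]_n) :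
  (forall i, d 0 i != 0) -> invmx (diag_mx d) = diag_mx (\row_i (d 0 i)^-1).
Proof.
move=> d0.
have E : diag_mx d *m diag_mx (\row_i (d 0 i)^-1) = 1%:M.
  rewrite mulmx_diag -diag_const_mx; congr diag_mx.
  by apply/rowP=> i; rewrite !mxE divff.
have [U _] := mulmx1_unit E.
by rewrite -[LHS]mulmx1 -E mulKmx.
Qed.

(* Enumerates the possible coincidences among the indices compared in the goal. *)
Ltac split_eqs := repeat (rewrite ?eqxx; match goal with
  | H : is_true (?a != ?b) |- context [?a == ?b] => rewrite (negbTE H)
  | H : is_true (?a != ?b) |- context [?b == ?a] => rewrite [b == a]eq_sym (negbTE H)
  | |- context [?a == ?b] => have [?|?] := eqVneq a b; [subst|]
  end).

(** * Curvature of a diagonal metric whose entries depend on one coordinate *)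

Section DiagonalMetric.
Variables (R : realType) (m : nat) (e : 'I_m.+1).
Variables (G H dH : 'I_m.+1 -> R -> R) (g : 'rV[R]_m.+1 -> 'M[R]_m.+1).
Hypothesis gE : forall x, g x = diag_mx (\row_i G i (x 0 e)).
Hypothesis G_neq0 : forall i (s : R), 0 < s -> G i s != 0.
Hypothesis G_deriv : forall i (s : R), 0 < s -> is_derive s 1 (G i) (2 * H i s * G i s).
Hypothesis H_deriv : forall i (s : R), 0 < s -> is_derive s 1 (H i) (dH i s).

Definition diag_christoffel (k i j : 'I_m.+1) (s : R) : R :=
  ((i == e) && (j == k))%:R * H k s + ((j == e) && (i == k))%:R * H k s
  - ((k == e) && (i == j))%:R * (H i s * G i s / G k s).

(** The last summand reflects that [G i / G k] has logarithmic derivative [2 * (H i - H k)]. *)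
Definition diag_christoffel_deriv (k i j : 'I_m.+1) (s : R) : R :=
  ((i == e) && (j == k))%:R * dH k s + ((j == e) && (i == k))%:R * dH k s
  - ((k == e) && (i == j))%:R *
    ((dH i s + 2 * H i s * (H i s - H k s)) * G i s / G k s).

Lemma christoffel_diag k i j (x : 'rV[R]_m.+1) : 0 < x 0 e ->
  christoffel g k i j x = diag_christoffel k i j (x 0 e).
Proof.
move=> x0; rewrite /christoffel gE invmx_diag; last by move=> l; rewrite mxE G_neq0.
have P a b c : partial a (fun y => g y b c) x =
    ((b == c) && (a == e))%:R * (2 * H b (x 0 e) * G b (x 0 e)).
  have E : (fun y => g y b c) = fun y => ((b == c)%:R \*: G b) (y 0 e).
    by apply/funext => y; rewrite gE !mxE; exact/esym/mulr_natl.
  rewrite E (partial_coord ((b == c)%:R \*: G b)) derive1E.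
  have d := G_deriv b x0; rewrite derive_val.
  by case: (a == e); case: (b == c); rewrite /= ?mul0r ?mul1r ?scale0r ?scale1r.
rewrite (bigD1 k) //= big1 ?addr0; last first.
  by move=> l lk; rewrite !mxE eq_sym (negbTE lk) mulr0n mul0r.
rewrite !mxE eqxx mulr1n !P /diag_christoffel ![_ == k]eq_sym.
have G0 := G_neq0 k x0.
have [<-|kj] := eqVneq k j; have [<-|ki] := eqVneq k i;
  by rewrite /= ?eqxx /= ?andbT ?andbF ?[(_ == _) && (k == e)]andbC /=; field.
Qed.

Lemma is_derive_diag_christoffel k i j (s : R) : 0 < s ->
  is_derive s 1 (diag_christoffel k i j) (diag_christoffel_deriv k i j s).
Proof.
move=> s0.
have di := G_deriv i s0; have dk := G_deriv k s0.
have hi := H_deriv i s0; have hk := H_deriv k s0.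
have G0 := G_neq0 k s0.
have dV := is_deriveV G0 dk.
rewrite /diag_christoffel.
apply: is_derive_eq.
by rewrite /diag_christoffel_deriv /GRing.scale /=; field.
Qed.

(** Each summand of the Christoffel symbol carries a delta that pins [p], to [l], [e] and [i] in
    turn. With [F] a second symbol, this evaluates the quadratic terms of the Riemann tensor in any
    dimension. *)
Lemma sum_diag_christoffel (F : 'I_m.+1 -> R) l i s :
  \sum_(p < m.+1) diag_christoffel l i p s * F p =
    (i == e)%:R * H l s * F l + (i == l)%:R * H l s * F e
    - (l == e)%:R * (H i s * G i s / G l s) * F i.
Proof.
have S a (c : R) (b : bool) :
    \sum_(p < m.+1) (b && (p == a))%:R * c * F p = b%:R * c * F a.
  rewrite (bigD1 a) //= eqxx andbT big1 ?addr0 // => p /negbTE->.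
  by rewrite andbF !mul0r.
under eq_bigr => p _ do rewrite !mulrDl mulNr [(p == e) && _]andbC [i == p]eq_sym.
by rewrite !big_split /= sumrN !S.
Qed.

(* The value at [l = k] is a convention: it lets the sums of [diag_ricci] and
   [diag_weyl] run over all indices. *)
Definition diag_sectional (l k : 'I_m.+1) (s : R) : R :=
  - (if l == k then 0
     else if l == e then dH k s + H k s ^+ 2 - H e s * H k s
     else if k == e then dH l s + H l s ^+ 2 - H e s * H l s
     else H l s * H k s) / G e s.

Lemma riemann_diag l k i j (x : 'rV[R]_m.+1) : 0 < x 0 e ->
  let s := x 0 e in
  riemann g l k i j x = diag_sectional l k s * G k s *
    (((l == i) && (k == j))%:R - ((l == j) && (k == i))%:R).
Proof.
move=> x0 s; rewrite /riemann.
have P a b c d := partial_near_coord a (@christoffel_diag b c d) x0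
                    (is_derive_diag_christoffel b c d x0).
rewrite !P; under eq_bigr => p _ do rewrite !christoffel_diag // -/s.
rewrite -/s big_split /= sumrN !sum_diag_christoffel.
have N a := G_neq0 a x0; rewrite -/s in N.
rewrite /diag_christoffel_deriv /diag_christoffel /diag_sectional.
(* For [i = j] both sides vanish by antisymmetry. Otherwise each pattern of coincidences among [l],
   [k], [i], [j], [e] leaves a rational identity in [G], [H], [dH]. *)
have [<-|ij] := eqVneq i j; first by rewrite !subrr mulr0 addr0.
by clearbody s; split_eqs; rewrite /=; field; rewrite ?N.
Qed.

Lemma riemann_low_diag l k i j (x : 'rV[R]_m.+1) : 0 < x 0 e ->
  let s := x 0 e in
  riemann_low g l k i j x = diag_sectional l k s * G l s * G k s *
    (((l == i) && (k == j))%:R - ((l == j) && (k == i))%:R).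
Proof.
move=> x0 s; rewrite /riemann_low (bigD1 l) //= big1 ?addr0; last first.
  by move=> p pl; rewrite gE !mxE eq_sym (negbTE pl) mul0r.
by rewrite riemann_diag // gE !mxE eqxx mulr1n; ring.
Qed.

Definition diag_ricci (k : 'I_m.+1) (s : R) : R := \sum_(i < m.+1) diag_sectional i k s.

Lemma ricci_diag k j (x : 'rV[R]_m.+1) : 0 < x 0 e ->
  ricci g k j x = (k == j)%:R * (diag_ricci k (x 0 e) * G k (x 0 e)).
Proof.
move=> x0; rewrite /ricci /diag_ricci mulr_suml mulr_sumr; apply: eq_bigr => i _.
rewrite riemann_diag // eqxx.
(* For [i = k] both sides vanish by the convention on [diag_sectional]; for [i != k] only the first
   product of deltas survives. *)
have [->|_] := eqVneq i k; first by rewrite /diag_sectional eqxx oppr0 !mul0r mulr0.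
by rewrite andbF subr0 mulrC.
Qed.

Lemma scalar_curv_diag (x : 'rV[R]_m.+1) : 0 < x 0 e ->
  scalar_curv g x = \sum_(k < m.+1) diag_ricci k (x 0 e).
Proof.
move=> x0; apply: eq_bigr => k _.
rewrite gE invmx_diag; last by move=> l; rewrite mxE G_neq0.
rewrite (bigD1 k) //= big1 ?addr0; last first.
  by move=> l lk; rewrite !mxE eq_sym (negbTE lk) mulr0n mul0r.
by rewrite ricci_diag // !mxE eqxx mulr1n mul1r mulrC mulfK // G_neq0.
Qed.

Definition diag_weyl (l k : 'I_m.+1) (s : R) : R :=
  let n : R := m.+1%:R in
  diag_sectional l k s - (n - 2)^-1 * (diag_ricci l s + diag_ricci k s)
  + (\sum_(p < m.+1) diag_ricci p s) / ((n - 1) * (n - 2)).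

Lemma weyl_diag l k i j (x : 'rV[R]_m.+1) : 0 < x 0 e ->
  let s := x 0 e in
  weyl g l k i j x = diag_weyl l k s * G l s * G k s *
    (((l == i) && (k == j))%:R - ((l == j) && (k == i))%:R).
Proof.
move=> x0 s; rewrite /weyl riemann_low_diag // !ricci_diag // scalar_curv_diag //.
rewrite gE !mxE -/s /diag_weyl.
(* The identity holds with arbitrary coefficients in place of [1/(n-2)] and of the scalar curvature
   term. *)
move: (_ - 2)^-1 (_ / _) => a b; split_eqs; rewrite /= ?mulr1n ?mulr0n; ring.
Qed.

End DiagonalMetric.

(** * The metric in the coordinates (t, r, z, phi) *)

Section Param.
Variable R : realType.
Implicit Type x : 'rV[R]_4.

Lemma paramE x (k : 'I_5) :
  param x 0 k = nth id [:: id; id; id; @cos R; @sin R] k (x 0 (nth 0 [:: 0; 1; 2; 3; 3] k)).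
Proof. by rewrite mxE; case: k => [[|[|[|[|[|]]]]]]. Qed.

Lemma is_derive_param_fun (k : 'I_5) (s : R) :
  is_derive s 1 (nth id [:: id; id; id; @cos R; @sin R] k)
    [:: 1; 1; 1; - sin s; cos s]`_k.
Proof. by case: k => [[|[|[|[|[|//]]]]] ?] /=; exact: _. Qed.

Lemma differentiable_param x : differentiable (@param R) x.
Proof.
have -> : @param R = \sum_(k < 5) (fun y => @param R y 0 k *: delta_mx 0 k).
  by apply/funext => y; rewrite fct_sumE -row_sum_delta.
apply: differentiable_sum => k; apply: differentiableZl.
under eq_fun do rewrite paramE.
by apply: differentiable_fun_coord; apply: ex_derive; exact: is_derive_param_fun.
Qed.

Lemma jacobian_param x :
  'J (@param R) x = \matrix_(i, k)
     ((i == nth 0 [:: 0; 1; 2; 3; 3] k)%:R * [:: 1; 1; 1; - sin (x 0 3); cos (x 0 3)]`_k).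
Proof.
apply/matrixP => i k.
have d := differentiable_param x.
(* The derivative along the [i]-th axis is the [i]-th row of the Jacobian. *)
have := deriveEjacobian (delta_mx 0 i) d.
rewrite derive_mx; last exact: diff_derivable.
rewrite -rowE => /rowP/(_ k); rewrite ![in LHS]mxE [in RHS]mxE => <-.
under eq_fun do rewrite paramE.
rewrite [LHS]partial_coord derive1E.
have D := is_derive_param_fun k; rewrite derive_val !mxE.
by case: k D => [[|[|[|[|[|//]]]]] ?] D /=.
Qed.

(** The pullback of u dv - v du is the coordinate covector of phi, because cos^2 + sin^2 = 1. *)
Lemma dphi_jacobian_param x :
  dphi (param x) *m ('J (@param R) x)^T = delta_mx 0 3.
Proof.
apply/rowP => i; rewrite jacobian_param !mxE !big_ord_recl big_ord0 !mxE /=.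
have := cos2Dsin2 (x 0 3).
case: i => [[|[|[|[|//]]]] ?]; rewrite -!val_eqE /= => E; try ring.
by rewrite -[RHS]E; ring.
Qed.

Definition metric_entry (f : R -> R) (i : nat) (s : R) : R :=
  [:: - expR (2 * f s); expR (2 * f s); expR (2 * f s); s ^+ 2 * expR (- (2 * f s))]`_i.

Lemma metric_coordE (f : R -> R) x :
  metric_coord f x = diag_mx (\row_i metric_entry f i (x 0 1)).
Proof.
rewrite /metric_coord /metric mulmxDr mulmxDl -!scalemxAr -!scalemxAl.
have E : 'J (@param R) x *m ((dphi (param x))^T *m dphi (param x)) *m ('J (@param R) x)^T
  = delta_mx 3 3.
  rewrite !mulmxA -[_ *m (dphi _)^T]trmxK trmx_mul trmxK -!mulmxA.
  by rewrite dphi_jacobian_param trmx_delta mul_delta_mx.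
rewrite E jacobian_param mul_mx_diag; apply/matrixP => a b.
rewrite !mxE !big_ord_recl big_ord0 !mxE /=.
case: a => [[|[|[|[|//]]]] ?]; case: b => [[|[|[|[|//]]]] ?];
  by rewrite -!val_eqE /= /metric_entry /=; ring.
Qed.

End Param.

(** * The Weyl tensor of the given class of metrics *)

Section WeylClass.
Variables (R : realType) (f : R -> R).
Hypothesis hf : smooth_on [set r : R | 0 < r] f.

Local Notation f1 := (f^`()%classic).
Local Notation f2 := (f^`(2)%classic).

(** The sign of the [t] entry drops out of its logarithmic derivative, so [t], [r] and [z] share the
    value f'. *)
Definition half_dlog (i : nat) (s : R) : R := [:: f1 s; f1 s; f1 s; s^-1 - f1 s]`_i.
Definition half_dlog_deriv (i : nat) (s : R) : R := [:: f2 s; f2 s; f2 s; - s ^- 2 - f2 s]`_i.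

Lemma metric_entry_neq0 (i : 'I_4) (s : R) : 0 < s -> metric_entry f i s != 0.
Proof.
move=> s0; have E c : expR c != 0 by rewrite gt_eqF ?expR_gt0.
by case: i => [[|[|[|[|//]]]] ?];
  rewrite /metric_entry /= ?oppr_eq0 ?mulf_eq0 ?negb_or ?E ?expf_neq0 ?gt_eqF.
Qed.

Lemma is_derive_f (s : R) : 0 < s -> is_derive s 1 f (f1 s).
Proof. by move=> s0; rewrite derive1E; apply: DeriveDef => //; exact: (@hf 0%N s s0). Qed.

Lemma is_derive_f1 (s : R) : 0 < s -> is_derive s 1 f1 (f2 s).
Proof.
move=> s0; rewrite derive1nS derive1n1 derive1E.
by apply: DeriveDef => //; exact: (@hf 1%N s s0).
Qed.

Lemma is_derive_metric_entry (i : 'I_4) (s : R) : 0 < s ->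
  is_derive s 1 (metric_entry f i) (2 * half_dlog i s * metric_entry f i s).
Proof.
move=> s0; have d := is_derive_f s0.
have dE c : is_derive s 1 (fun t => expR (c * f t)) (expR (c * f s) * (c * f1 s)).
  exact: (@is_derive1_comp R expR (c \*: f)).
have dE2 := dE 2.
have dB : is_derive s 1 (fun t => t ^+ 2 * expR (- (2 * f t)))
    (2 * (s^-1 - f1 s) * (s ^+ 2 * expR (- (2 * f s)))).
  under eq_fun do rewrite -mulNr.
  have dE' := dE (-2).
  apply: is_derive_eq; rewrite /GRing.scale /=; rewrite mulNr; field.
  by rewrite gt_eqF.
case: i => [[|[|[|[|//]]]] ?]; rewrite /metric_entry /half_dlog //=.
all: apply: is_derive_eq; ring.
Qed.

Lemma is_derive_half_dlog (i : 'I_4) (s : R) : 0 < s ->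
  is_derive s 1 (half_dlog i) (half_dlog_deriv i s).
Proof.
move=> s0; have d := is_derive_f1 s0.
have dV : is_derive s 1 (fun t : R => t^-1) (- s ^- 2).
  by apply: is_derive_eq; [apply: is_deriveV; rewrite gt_eqF|rewrite /GRing.scale /= mulr1].
by case: i => [[|[|[|[|//]]]] ?]; rewrite /half_dlog /half_dlog_deriv //=; exact: _.
Qed.

Lemma weyl_metric_coord (l k i j : 'I_4) (x : 'rV[R]_4) : 0 < x 0 1 ->
  let s := x 0 1 in
  let W := diag_weyl 1 (fun i => metric_entry f i) (fun i => half_dlog i)
             (fun i => half_dlog_deriv i) in
  weyl (metric_coord f) l k i j x =
    W l k s * metric_entry f l s * metric_entry f k s *
    (((l == i) && (k == j))%:R - ((l == j) && (k == i))%:R).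
Proof.
move=> x0 s W.
apply: (@weyl_diag R 3 1 (fun i => metric_entry f i) (fun i => half_dlog i)
             (fun i => half_dlog_deriv i)) => //.
- exact: metric_coordE.
- exact: metric_entry_neq0.
- exact: is_derive_metric_entry.
- exact: is_derive_half_dlog.
Qed.

(** Trace-freeness in dimension 4 makes complementary planes agree and the values at each index sum
    to zero; the symmetry between [t] and [z] then leaves one unknown, with ratios -1 : 2 : -1. Even
    [l + k] singles out the planes tz and r phi. The proof checks all pairs directly. *)
Lemma diag_weylE (l k : 'I_4) (s : R) : l != k ->
  diag_weyl 1 (fun i => metric_entry f i) (fun i => half_dlog i)
    (fun i => half_dlog_deriv i) l k s =
  (if odd (l + k) then - 1 else 2) / 3 *
  ((f2 s - 2 * f1 s ^+ 2 + 2 * f1 s / s) / expR (2 * f s)).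
Proof.
rewrite /diag_weyl /diag_ricci /diag_sectional !big_ord_recl !big_ord0.
rewrite /metric_entry /half_dlog /half_dlog_deriv -exprVn.
(* The inverses of [s] and of [expR (2 * f s)] become free variables, so each case is a polynomial
   identity. *)
move: (expR (2 * f s)) (f1 s) (f2 s) (s^-1) => A a b u.
rewrite -!val_eqE /=; move: A^-1 => v.
by case: l => [[|[|[|[|//]]]] ?]; case: k => [[|[|[|[|//]]]] ?]; rewrite /= => // _; field.
Qed.

End WeylClass.

Theorem lemma3p1 (R : realType) (f : R -> R)
    (hf : smooth_on [set r : R | 0 < r] f) :
  weyl_vanishes f <->
  (forall r : R, 0 < r ->
     r * f^`(2)%classic r - 2 * r * (f^`()%classic r) ^+ 2
     + 2 * f^`()%classic r = 0).
Proof.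
(* The equation is [r] times the common factor of the Weyl components. *)
have Q r (a b : R) : 0 < r -> r * b - 2 * r * a ^+ 2 + 2 * a =
    r * (b - 2 * a ^+ 2 + 2 * a / r) by move=> r0; field; rewrite gt_eqF.
split=> [W r r0|E p [p0 _] x xp l k i j].
- pose x : 'rV[R]_4 := \row_i ((i == 1)%:R * r).
  have xr : x 0 1 = r by rewrite mxE mul1r.
  have px : spacetime (param x) by split; rewrite !mxE /= ?cos2Dsin2 ?mul1r.
  (* One component suffices: in the tr plane the factor has coefficient -1/3, and the metric entries
     are nonzero. *)
  move/eqP: (W _ px _ erefl 0 1 0 1).
  rewrite weyl_metric_coord ?xr // diag_weylE // !mulf_eq0.
  rewrite !(negbTE (metric_entry_neq0 f _ r0)) !invr_eq0 (gt_eqF (expR_gt0 _)).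
  rewrite !eqxx subr0 oppr_eq0 oner_eq0 pnatr_eq0 !orbF => /eqP.
  by rewrite Q // => ->; rewrite mulr0.
- have x0 : 0 < x 0 1 by rewrite -xp mxE in p0.
  rewrite weyl_metric_coord //.
  (* For [l = k] the antisymmetric delta factor is zero, whatever [diag_weyl] is there. *)
  have [<-|lk] := eqVneq l k; first by rewrite andbC subrr mulr0.
  move/eqP: (E _ x0); rewrite Q // mulf_eq0 gt_eqF //= => /eqP E0.
  by rewrite diag_weylE // E0 mul0r mulr0 !mul0r.
Qed.
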